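(* Let $n,m$ be positive integers such that $m\geq n$, and let $s$ be a real number such that $1/2<s<1$. Then there is a constant $c$ (independent of $n$ and $m$) such that $$P_0(n,m)<\frac{c\, d(m)\,m^{2s}}{n^3}=O\left(\frac{m^{2s+o(1)}}{n^3}\right).$$
   Context: $d(m)$ denotes the number of positive divisors of $m$. For the given $s$, $P_0(n,m)$ denotes the proportion of elements $g$ of the symmetric group $S_n$ whose order divides $m$ and all of whose cycles (including fixed points) are $s$-small, where a cycle of length $d$ (a divisor of $m$) is called $s$-small if $d<m^s$. In other words, $P_0(n,m)$ is the proportion of $g\in S_n$ all of whose cycle lengths divide $m$ and are strictly less than $m^s$. The constant $c$ may depend on $s$. The expression $O(m^{2s+o(1)}/n^3)$ means that for every $\varepsilon>0$ there is a constant $C$, depending only on $s$ and $\varepsilon$, such that the quantity is at most $C m^{2s+\varepsilon}/n^3$ for all positive integers $m\ge n$. *)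

(* Defs.v *)
From mathcomp Require Import all_boot all_order all_algebra all_fingroup.
From mathcomp Require Import reals exp.

Set Implicit Arguments.
Unset Strict Implicit.
Unset Printing Implicit Defensive.

Import Order.TTheory GRing.Theory Num.Theory.

Local Open Scope ring_scope.

Definition num_divisors (m : nat) : nat := size (divisors m).

Definition s_small {R : realType} (s : R) (m d : nat) : bool :=
  d%:R < m%:R `^ s.

(* [porbits g] is the set of supports of the cycles of [g], with fixed points
   included as singletons. *)
Definition P0 {R : realType} (s : R) (n m : nat) : R :=
  #|[set g : 'S_n | (#[g]%g %| m)%N &
                    [forall C in porbits g, s_small s m #|C|]]|%:R
  / #|'S_n|%:R.

(* Main.v *)
(** Call g admissible if every cycle length of g divides m and is below M = m^s,
and let a_k(g) count the k-tuples of points lying in k distinct cycles of g.  If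
g is admissible then k cycles cover at most kM points, so
n a_k <= k M a_k + a_(k+1), and hence n^3 <= M^2 a_1 + 3 M a_2 + a_3.
For prescribed cycle lengths d_1, ..., d_k there are at most n! pairs made of a
permutation and a k-tuple of points in distinct cycles of these lengths, so the
sum of a_k over the admissible g is at most d(m)^k n!.  Dividing by n!,
n^3 P0 <= d(m) M^2 + 3 d(m)^2 M + d(m)^3, and d(m) = O(m^s) concludes.
The bound d(m) = O(m^eps) holds since each factor (e+1)/p^(e eps) of d(m)/m^eps
is bounded, and is at most 1 unless p < 2^(1/eps). *)

Require Import Defs.
From mathcomp Require Import all_boot all_order all_algebra all_fingroup.
From mathcomp Require Import reals exp.
From mathcomp Require Import ring lra zify.

Set Implicit Arguments.
Unset Strict Implicit.
Unset Printing Implicit Defensive.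

Import Order.TTheory GRing.Theory Num.Theory.

(** * Counting tuples of points in distinct cycles *)

Section CycleMoments.
Local Open Scope nat_scope.
Variable T : finType.
Implicit Types (g : {perm T}) (x y : T) (xs : seq T).

Definition cycle_list g x := traject g x #|porbit g x|.

Definition cycle_word g xs := flatten [seq cycle_list g x | x <- xs].

(* Given the cycle lengths of the points [xs], this arrangement of [T] determines
   both [g] and [xs]: the cycles can be cut out of it, and the remaining entries
   are the values of [g] on the other points, listed in order. *)
Definition cycle_code g xs :=
  cycle_word g xs ++ [seq g y | y <- enum T & y \notin cycle_word g xs].

Definition cycle_lengths g xs := [seq #|porbit g x| | x <- xs].

Lemma shape_cycle_lists g xs :
  shape [seq cycle_list g x | x <- xs] = cycle_lengths g xs.
Proof.
by rewrite /shape -map_comp; apply: eq_map => x /=; rewrite size_traject.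
Qed.

Lemma mem_cycle_list g x y : (y \in cycle_list g x) = (y \in porbit g x).
Proof. by rewrite porbit_traject. Qed.

Lemma mem_cycle_word g xs y :
  (y \in cycle_word g xs) = has (fun x => y \in porbit g x) xs.
Proof.
by elim: xs => //= x xs IH; rewrite /cycle_word /= mem_cat mem_cycle_list -IH.
Qed.

(** A union of cycles is stable under [g], so the values of [g] listed in the second half of
    [cycle_code] avoid the first half. *)
Lemma perm_mem_cycle_word g xs y :
  (g y \in cycle_word g xs) = (y \in cycle_word g xs).
Proof.
rewrite !mem_cycle_word; apply: eq_has => x.
by rewrite -!eq_porbit_mem -[g y]/((g ^+ 1)%g y) porbit_perm.
Qed.

Lemma size_cycle_code g xs :
  uniq (cycle_word g xs) -> size (cycle_code g xs) = #|T|.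
Proof.
move=> /card_uniqP cw; rewrite size_cat size_map size_filter -cw.
rewrite -(cardC (mem (cycle_word g xs))); congr (_ + _).
by rewrite [RHS]cardE [RHS]size_filter -enumT.
Qed.

Lemma cycle_code_perm g xs :
  uniq (cycle_word g xs) -> cycle_code g xs \in permutations (enum T).
Proof.
move=> uw; rewrite mem_permutations.
have uc : uniq (cycle_code g xs).
  rewrite cat_uniq uw (map_inj_uniq (@perm_inj _ g)) filter_uniq ?enum_uniq //.
  rewrite andbT /=; apply/hasPn => _ /mapP[y yn ->].
  by move: yn; rewrite mem_filter /= perm_mem_cycle_word => /andP[].
have sub : {subset cycle_code g xs <= enum T} by move=> z _; rewrite mem_enum.
apply: uniq_perm (enum_uniq _) _ => //.
have [|_ //] := uniq_min_size uc sub.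
by rewrite size_cycle_code // cardE.
Qed.

Lemma eq_cycle_list g h x : cycle_list g x = cycle_list h x ->
  {in porbit g x, g =1 h}.
Proof.
move=> e; have sz : #|porbit g x| = #|porbit h x|.
  by move/(congr1 size): e; rewrite !size_traject.
(* The index equal to the cycle length is included: there both iterates are back at [x], which
   settles the image of the last entry of the list. *)
have it i : i <= #|porbit g x| -> iter i g x = iter i h x.
  rewrite leq_eqVlt => /orP[/eqP ->|lti].
    by rewrite iter_porbit sz iter_porbit.
  move/(congr1 (fun s => nth x s i)): e.
  by rewrite /cycle_list !nth_traject // -sz.
move=> y; rewrite porbit_traject => /trajectP[i lti ->].
by rewrite -iterS it // iterS it // ltnW.
Qed.

(** Equal lengths cut the common word at the same places. Each piece is nonempty, starts at its base
    point and determines the permutation on its cycle. *)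
Lemma eq_cycle_word g h xs ys : cycle_lengths g xs = cycle_lengths h ys ->
  cycle_word g xs = cycle_word h ys ->
  xs = ys /\ {in cycle_word g xs, g =1 h}.
Proof.
rewrite -!shape_cycle_lists => es ew.
have {es ew} := eq_from_flatten_shape ew es.
elim: xs ys => [|x xs IH] [|y ys] //= [] exy /IH[-> IHg].
have exy' : x = y.
  move: exy; rewrite /cycle_list.
  case: #|porbit g x| (card_porbit_neq0 g x) => // a _.
  by case: #|porbit h y| (card_porbit_neq0 h y) => // b _ [].
move: exy; rewrite -{}exy' => exy; split=> // z.
rewrite /cycle_word /= mem_cat mem_cycle_list => /orP[]; last exact: IHg.
exact: eq_cycle_list exy z.
Qed.

Lemma cycle_code_inj g h xs ys : cycle_lengths g xs = cycle_lengths h ys ->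
  cycle_code g xs = cycle_code h ys -> g = h /\ xs = ys.
Proof.
move=> el ec.
have sw k zs : size (cycle_word k zs) = sumn (cycle_lengths k zs).
  by rewrite size_flatten shape_cycle_lists.
have ew : cycle_word g xs = cycle_word h ys.
  move/(congr1 (take (size (cycle_word g xs)))): ec.
  by rewrite take_size_cat // take_size_cat // !sw el.
have [exs eg] := eq_cycle_word el ew; split=> //.
have /eq_in_map er : [seq g y | y <- enum T & y \notin cycle_word g xs] =
    [seq h y | y <- enum T & y \notin cycle_word g xs].
  move/(congr1 (drop (size (cycle_word g xs)))): ec.
  by rewrite drop_size_cat // drop_size_cat // ?ew.
apply/permP => y; case: (boolP (y \in cycle_word g xs)) => [/eg //|yn].
by apply: er; rewrite mem_filter yn mem_enum.
Qed.

Definition sequences (D : seq nat) k :=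
  iter k (fun W => [seq d :: w | d <- D, w <- W]) [:: [::]].

Lemma size_sequences D k : size (sequences D k) = size D ^ k.
Proof. by elim: k => //= k IH; rewrite size_allpairs IH expnS. Qed.

Lemma mem_sequences (D : seq nat) s : all (mem D) s -> s \in sequences D (size s).
Proof.
by elim: s => //= d s IH /andP[dD /IH sD]; apply/allpairsP; exists (d, s).
Qed.

(** A single cycle list has no repetition, so uniqueness of the word says that the [k] points lie in
    distinct cycles. *)
Definition separated k g := [set xs : k.-tuple T | uniq (cycle_word g xs)].

(** A pair of a permutation and a separated tuple is encoded injectively by its sequence of cycle
    lengths, a word of length [k] over [D], and an arrangement of [T]. *)
Lemma sum_separated (A : {set {perm T}}) (D : seq nat) k :
  {in A, forall g x, #|porbit g x| \in D} ->
  \sum_(g in A) #|separated k g| <= size D ^ k * #|T|`!.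
Proof.
move=> AD.
pose P := [set p : {perm T} * k.-tuple T |
  (p.1 \in A) && (p.2 \in separated k p.1)].
have -> : \sum_(g in A) #|separated k g| = #|P|.
  under eq_bigr do rewrite -sum1_card.
  by rewrite pair_big_dep sum1dep_card; apply: eq_card => p; rewrite !inE.
pose f (p : {perm T} * k.-tuple T) := (cycle_lengths p.1 p.2, cycle_code p.1 p.2).
have finj : {in enum P &, injective f}.
  move=> [g xs] [h ys] _ _ [el ec].
  by have [-> /val_inj ->] := cycle_code_inj el ec.
rewrite cardE -(size_map f).
pose Q := [seq (t, w) | t <- sequences D k, w <- permutations (enum T)].
apply: (@leq_trans (size Q)); last first.
  by rewrite size_allpairs size_sequences size_permutations ?enum_uniq // cardE.
apply: uniq_leq_size; first by rewrite map_inj_in_uniq ?enum_uniq.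
move=> _ /mapP[[g xs] + ->]; rewrite mem_enum !inE /= => /andP[gA uw].
apply/allpairsP; exists (f (g, xs)); split=> //=; last exact: cycle_code_perm.
have sk : size (cycle_lengths g xs) = k by rewrite size_map size_tuple.
rewrite /= -{2}sk.
by apply: mem_sequences; apply/allP => _ /mapP[x _ ->]; apply: AD.
Qed.

Lemma uniq_cycle_word_cons g y xs : uniq (cycle_word g xs) ->
  y \notin cycle_word g xs -> uniq (cycle_word g (y :: xs)).
Proof.
move=> uw yn; rewrite /cycle_word /= cat_uniq uniq_traject_porbit uw andbT /=.
apply/hasPn => z zw; rewrite mem_cycle_list; apply: contra yn => zy.
move: zw; rewrite !mem_cycle_word; apply: sub_has => x.
by rewrite -!eq_porbit_mem => /eqP <-; rewrite eq_sym eq_porbit_mem.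
Qed.

(** A separated [k]-tuple extends by any point outside its cycles, and these cover at most [k * B]
    points. *)
Lemma separated_step g B k : (forall x, #|porbit g x| <= B) ->
  #|T| * #|separated k g| <= k * B * #|separated k g| + #|separated k.+1 g|.
Proof.
move=> leB.
pose Q := [set p : k.-tuple T * T |
  (p.1 \in separated k g) && (p.2 \notin cycle_word g p.1)].
have leQ : #|Q| <= #|separated k.+1 g|.
  pose f (p : k.-tuple T * T) := [tuple of p.2 :: p.1].
  rewrite -(@card_imset _ _ f); last first.
    by move=> [xs x] [ys y] /(congr1 val) [-> /val_inj ->].
  apply: subset_leq_card; apply/subsetP => _ /imsetP[[xs y] + ->].
  by rewrite !inE /= => /andP[uw yn]; apply: uniq_cycle_word_cons.
apply: leq_trans (leq_add (leqnn _) leQ).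
have -> : #|Q| = \sum_(xs in separated k g) #|[predC cycle_word g xs]|.
  under eq_bigr do rewrite -sum1_card.
  by rewrite pair_big_dep sum1dep_card; apply: eq_card => p; rewrite !inE.
rewrite mulnC -sum_nat_const [k * B * _]mulnC -sum_nat_const -big_split /=.
apply: leq_sum => xs _; rewrite -(cardC (mem (cycle_word g xs))) leq_add2r.
apply: leq_trans (card_size _) _.
rewrite size_flatten shape_cycle_lists /cycle_lengths.
rewrite -[k in k * B](size_tuple xs); elim: (val xs) => //= x s IH.
by rewrite mulSn leq_add.
Qed.

Lemma separated0 g : #|separated 0 g| = 1.
Proof.
rewrite -(expn0 #|T|) -(card_tuple 0 T); apply: eq_card => xs.
by rewrite !inE; case: xs => -[].
Qed.

Lemma card_bounded_cycles (A : {set {perm T}}) (D : seq nat) B :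
  {in A, forall g x, (#|porbit g x| \in D) && (#|porbit g x| <= B)} ->
  #|T| ^ 3 * #|A| <=
    (B ^ 2 * size D + 3 * B * size D ^ 2 + size D ^ 3) * #|T|`!.
Proof.
move=> AD; set n := #|T|; set k := size D.
have sumA j : \sum_(g in A) #|separated j g| <= k ^ j * n`!.
  by apply: sum_separated => g gA x; case/andP: (AD g gA x).
have pointwise g : g \in A -> n ^ 3 <=
    B ^ 2 * #|separated 1 g| + 3 * B * #|separated 2 g| + #|separated 3 g|.
  move=> gA; have leB x : #|porbit g x| <= B by case/andP: (AD g gA x).
  have := separated_step 0 leB; have := separated_step 1 leB.
  have := separated_step 2 leB; rewrite separated0 -/n.
  move: #|separated 1 g| #|separated 2 g| #|separated 3 g| => a1 a2 a3 h3 h2.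
  rewrite muln1 !mul0n add0n => h1; rewrite mul1n in h2.
  (* The coefficient 3 of [B * a2] arises as 1 + 2: one from bounding [B * (n * a1)], two from
     bounding [n * a2]. *)
  have e1 : n ^ 3 <= n * (n * a1) by rewrite !expnS expn0 muln1 !leq_mul.
  have e2 : n * (n * a1) <= n * (B * a1 + a2) by rewrite leq_mul2l h2 orbT.
  have e3 : n * (B * a1 + a2) <= B * (B * a1 + a2) + (2 * B * a2 + a3).
    by rewrite mulnDr mulnCA leq_add // leq_mul2l h2 orbT.
  apply: leq_trans e1 (leq_trans e2 (leq_trans e3 _)).
  by rewrite expnS expn1; lia.
rewrite mulnC -sum_nat_const.
apply: leq_trans (leq_sum _ pointwise) _; rewrite !big_split /= -!big_distrr /=.
move: (sumA 1) (sumA 2) (sumA 3); rewrite expn1.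
move: (\sum_(_ in _) _) (\sum_(_ in _) _) (\sum_(_ in _) _) => s3 s2 s1 h1 h2 h3.
rewrite 2!mulnDl -(mulnA (B ^ 2)) -(mulnA (3 * B)).
exact: leq_add (leq_add (leq_mul _ h1) (leq_mul _ h2)) h3.
Qed.

End CycleMoments.

(** * The divisor bound *)

Lemma num_divisors_prod m :
  num_divisors m = \prod_(f <- prime_decomp m) f.2.+1.
Proof.
rewrite /num_divisors /divisors; elim: (prime_decomp m) => [|[p e] pd IH] /=.
  by rewrite big_nil.
rewrite big_cons -IH /=; set L := foldr _ _ _.
(* Each of the [e] rounds for the prime [p] merges in one more copy of [L], so the length of [L]
   gets multiplied by [e.+1]. *)
elim: e => [|e IHe]; first by rewrite mul1n.
by rewrite iterS size_merge size_cat size_map IHe addnC mulSn.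
Qed.

Local Open Scope ring_scope.

Section DivisorBound.
Variable R : realType.

Lemma bernoulli_le (x : R) e : 0 <= x -> 1 + e%:R * x <= (1 + x) ^+ e.
Proof.
move=> x0; elim: e => [|e IH]; first by rewrite mul0r addr0 expr0.
rewrite exprSr; apply: le_trans (ler_wpM2r _ IH); last by rewrite addr_ge0.
have ex : 0 <= e%:R * x * x by rewrite !mulr_ge0.
by rewrite -natr1; lra.
Qed.

Lemma natr_powRX (p e : nat) (r : R) : (p ^ e)%:R `^ r = (p%:R `^ r) ^+ e.
Proof.
by rewrite natrX -powR_mulrn // -powRrM mulrC powRrM powR_mulrn // powR_ge0.
Qed.

Lemma num_divisors_le (eps : R) : 0 < eps ->
  exists2 C : R, 0 <= C &
    (* Every prime [p] has $p^{eps} \ge 1 + eta$. Bernoulli then gives growth at least $1 + e \cdot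
       eta$, and [K] is chosen to lift this above $e + 1$. *)
    forall m : nat, (0 < m)%N -> (num_divisors m)%:R <= C * m%:R `^ eps.
Proof.
move=> eps0; pose eta : R := 2 `^ eps - 1.
have eta0 : 0 < eta.
  by rewrite subr_gt0 -[ltLHS](congr1 (@^~ eps) (@powR1 R)) gt0_ltr_powR ?nnegrE ?ltr1n.
pose K := 1 + eta^-1.
have K1 : 1 <= K by rewrite lerDl invr_ge0 ltW.
have K0 : 0 <= K by apply: le_trans K1.
(* From [B] on, $p^{eps} \ge 2$, and $2^e \ge e + 1$ needs no constant. *)
pose B := (Num.truncn ((2 : R) `^ eps^-1)).+1.
have small (p e : nat) : (1 < p)%N -> e.+1%:R <= K * (p ^ e)%:R `^ eps.
  move=> p1; rewrite natr_powRX.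
  have p2 : 1 + eta <= p%:R `^ eps.
    by rewrite addrC subrK ge0_ler_powR ?nnegrE ?ler_nat // ltW.
  apply: (@le_trans _ _ (K * (1 + e%:R * eta))); last first.
    rewrite ler_wpM2l // (le_trans (bernoulli_le _ (ltW eta0))) //.
    by apply: lerXn2r p2; rewrite nnegrE ?powR_ge0 // addr_ge0 // ltW.
  have -> : K * (1 + e%:R * eta) = e.+1%:R + (e%:R * eta + eta^-1).
    rewrite /K -natr1; field; exact: lt0r_neq0.
  by rewrite lerDl addr_ge0 ?mulr_ge0 ?invr_ge0 // ltW.
have large (p e : nat) : (B <= p)%N -> e.+1%:R <= (p ^ e)%:R `^ eps.
  move=> Bp; rewrite natr_powRX.
  apply: (@le_trans _ _ (2 ^+ e)).
    by rewrite -natrX ler_nat ltn_expl.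
  rewrite lerXn2r // ?nnegrE ?powR_ge0 //.
  have -> : 2 = (2 `^ eps^-1) `^ eps :> R.
    by rewrite -powRrM mulVf ?gt_eqF // powRr1.
  rewrite ge0_ler_powR ?nnegrE ?powR_ge0 // ?ltW //.
  by rewrite -truncn_lt_nat ?powR_ge0.
have bound (pd : seq (nat * nat)) : all (fun f => 1 < f.1)%N pd ->
    (\prod_(f <- pd) f.2.+1)%:R <=
    K ^+ count (fun f => f.1 < B)%N pd * (\prod_(f <- pd) f.1 ^ f.2)%:R `^ eps.
  elim: pd => [|[p e] pd IH] /=; first by rewrite !big_nil powR1 mul1r.
  move=> /andP[p1 /IH {}IH]; rewrite !big_cons /= natrM [in leRHS]natrM powRM //.
  rewrite exprD mulrACA ler_pM //.
  by case: ltnP => Bp /=; rewrite ?expr1 ?expr0 ?mul1r ?small ?large.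
exists (K ^+ B); first by rewrite exprn_ge0.
move=> m m0; rewrite num_divisors_prod [in leRHS](prod_prime_decomp m0).
apply: le_trans (bound _ _) _.
  by apply/allP => -[p e] /mem_prime_decomp[/prime_gt1].
rewrite ler_wpM2r ?powR_ge0 // ler_weXn2l //.
(* The primes of the decomposition are distinct, so at most [B] of them lie below [B]. *)
rewrite -(count_map fst (fun p => p < B)%N) -size_filter -[leqRHS](size_iota 0).
apply: uniq_leq_size; first by rewrite filter_uniq // primes_uniq.
by move=> p; rewrite mem_filter mem_iota => /andP[].
Qed.

End DivisorBound.

(** * From cycle counts to the proportion *)

Lemma P0_le (R : realType) (s : R) (n m : nat) : (0 < n)%N -> (0 < m)%N ->
  P0 s n m <= ((num_divisors m)%:R * (m%:R `^ s) ^+ 2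
    + 3 * (num_divisors m)%:R ^+ 2 * m%:R `^ s
    + (num_divisors m)%:R ^+ 3) / n%:R ^+ 3.
Proof.
move=> n0 m0; rewrite /P0; set A := [set g | _ & _]; set M := m%:R `^ s.
set k := num_divisors m.
have M0 : 0 <= M by rewrite powR_ge0.
(* Cycle lengths are integers, so being below [M] bounds them by its integer part. *)
pose B := Num.truncn M.
have BM : B%:R <= M by rewrite -truncn_ge_nat.
have AD : {in A, forall g x,
    (#|porbit g x| \in divisors m) && (#|porbit g x| <= B)%N}.
  move=> g; rewrite inE => /andP[gm /forallP small] x.
  rewrite -dvdn_divisors // truncn_ge_nat //.
  (* A cycle is an orbit of the cyclic group of [g], so its length divides the order of [g]. *)
  rewrite porbitE (dvdn_trans (dvdn_orbit _ <[g]> x) gm) -porbitE /=.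
  by apply/ltW/(implyP (small (porbit g x))); apply: imset_f.
have := card_bounded_cycles AD; rewrite card_ord -/(num_divisors m) -/k.
rewrite -(ler_nat R) !(natrM, natrD, natrX) => le.
have cS : #|'S_n|%:R = n`!%:R :> R by rewrite card_Sn.
have f0 : 0 < n`!%:R :> R by rewrite ltr0n fact_gt0.
have n30 : 0 < n%:R ^+ 3 :> R by rewrite exprn_gt0 // ltr0n.
rewrite cS ler_pdivrMr // mulrAC ler_pdivlMr // mulrC (le_trans le) //.
rewrite ler_wpM2r ?(ltW f0) // lerD2r lerD //.
  by rewrite mulrC ler_wpM2l // lerXn2r // nnegrE.
by rewrite mulrAC ler_wpM2l // mulr_ge0 // exprn_ge0.
Qed.

Theorem theorem1p5 (R : realType) (s : R) (hs : 1 / 2 < s < 1) :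
  exists c : R,
    (forall n m : nat, (0 < n)%N -> (0 < m)%N -> (n <= m)%N ->
      P0 s n m < c * (num_divisors m)%:R * m%:R `^ (2 * s) / n%:R ^+ 3) /\
    (forall eps : R, 0 < eps ->
      exists C : R, forall n m : nat, (0 < n)%N -> (0 < m)%N -> (n <= m)%N ->
        c * (num_divisors m)%:R * m%:R `^ (2 * s) / n%:R ^+ 3
          <= C * m%:R `^ (2 * s + eps) / n%:R ^+ 3).
Proof.
have s0 : 0 < s by case/andP: hs => hs1 _; apply: lt_trans hs1; rewrite divr_gt0.
have [C C0 dC] := num_divisors_le s0.
(* With $d(m) \le C m^s$ the three terms of [P0_le] contribute 1, [3 * C] and [C ^+ 2]; the
   additional 1 makes the inequality strict. *)
pose c := 2 + 3 * C + C ^+ 2.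
have c0 : 0 <= c by rewrite !addr_ge0 ?mulr_ge0 ?exprn_ge0.
exists c; split=> [n m n0 m0 _|eps eps0]; last first.
  have [E E0 dE] := num_divisors_le eps0.
  exists (c * E) => n m _ m0 _.
  rewrite ler_wpM2r ?invr_ge0 ?exprn_ge0 // powRD; last first.
    by rewrite pnatr_eq0 -lt0n m0 implybT.
  rewrite -!mulrA ler_wpM2l // [X in _ <= _ * X]mulrC mulrA.
  by rewrite ler_wpM2r ?powR_ge0 // dE.
apply: le_lt_trans (P0_le _ n0 m0) _.
rewrite ltr_pM2r ?invr_gt0 ?exprn_gt0 ?ltr0n //.
have -> : m%:R `^ (2 * s) = (m%:R `^ s) ^+ 2 :> R.
  by rewrite mulrC powRrM powR_mulrn ?powR_ge0.
have : 0 < m%:R `^ s :> R by rewrite powR_gt0 ?ltr0n.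
have : 1 <= (num_divisors m)%:R :> R.
  rewrite ler1n /num_divisors -has_predT; apply/hasP; exists 1%N => //.
  by rewrite -dvdn_divisors ?dvd1n.
have := dC m m0; rewrite /c.
move: (num_divisors m)%:R (m%:R `^ s) => k M kM k1 M0.
have k0 : 0 <= k by apply: le_trans k1.
have kk : k ^+ 2 * M <= k * (C * M) * M.
  by rewrite expr2 ler_wpM2r ?(ltW M0) // ler_wpM2l.
have kkk : k ^+ 3 <= k * (C * M) ^+ 2.
  by rewrite exprS ler_wpM2l // lerXn2r // nnegrE // mulr_ge0 // ltW.
have kM2 : 0 < k * M ^+ 2 by rewrite mulr_gt0 ?exprn_gt0 // (lt_le_trans _ k1).
have -> : (2 + 3 * C + C ^+ 2) * k * M ^+ 2 =
  k * M ^+ 2 + k * M ^+ 2 + 3 * (k * (C * M) * M) + k * (C * M) ^+ 2 by ring.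
by rewrite -[3 * k ^+ 2 * M]mulrA; lra.
Qed.
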